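(* Let $G,H$ be graphs and let $\odot$ be an adjacency product. Then $$\bigcup_{k\in S_b(G),\,k'\in S_b(H)}S_b(K_k\odot K_{k'})\subseteq \left(\bigcup_{k\in S_b(H)}S_b(G\odot K_k)\right)\cap\left(\bigcup_{k\in S_b(G)}S_b(K_k\odot H)\right),$$ and $$\left(\bigcup_{k\in S_b(H)}S_b(G\odot K_k)\right)\cup\left(\bigcup_{k\in S_b(G)}S_b(K_k\odot H)\right)\subseteq S_b(G\odot H).$$
   Context: Graphs are finite, simple and nonempty; $K_n$ is the complete graph on $n$ vertices. For a proper coloring $f:V(G)\to\{1,\dots,k\}$, a vertex $v$ is a b-vertex if it has at least one neighbor in every color class $j\in\{1,\dots,k\}$, $j\neq f(v)$. A b-coloring with $k$ colors is a proper coloring with $k$ colors in which each of the $k$ color classes contains a b-vertex. The b-spectrum $S_b(G)$ is the set of positive integers $k$ for which $G$ has a b-coloring with $k$ colors. An adjacency product $\odot$ assigns to graphs $G,H$ the simple graph $G\odot H$ on $V(G)\times V(H)$ in which $\alpha=(u_a,v_a)$ and $\beta=(u_b,v_b)$ are adjacent iff a condition $P_\odot(G,H,\alpha,\beta)$ holds, where $P_\odot$ is a fixed formula (the same for all $G,H$) built by conjunctions and disjunctions (no negations) from a subset of the four basic formulas $u_a=u_b$, $v_a=v_b$, $u_au_b\in E(G)$, $v_av_b\in E(H)$; since the product is a simple graph, $P_\odot(G,H,\alpha,\alpha)$ never holds. *)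

(* Defs.v *)
From mathcomp Require Import all_boot.
From mathcomp Require Import classical_sets.

Set Implicit Arguments.
Unset Strict Implicit.
Unset Printing Implicit Defensive.

(* Nonemptiness of the vertex set is not part of the record, so that
   [complete_graph n] below is defined for every [n]. *)
Record sgraph := SGraph {
  vertex :> finType;
  edge : rel vertex;
  edge_sym : symmetric edge;
  edge_irr : irreflexive edge
}.

Section Complete.
Variable n : nat.
Definition complete_rel : rel 'I_n := fun x y => x != y.
Lemma complete_sym : symmetric complete_rel.
Proof. by move=> x y; rewrite /complete_rel eq_sym. Qed.
Lemma complete_irr : irreflexive complete_rel.
Proof. by move=> x; rewrite /complete_rel eqxx. Qed.
Definition complete_graph : sgraph := SGraph complete_sym complete_irr.
End Complete.

Section BColoring.
Variables (G : sgraph) (k : nat).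
Implicit Type f : G -> 'I_k.

Definition proper_coloring f : Prop :=
  forall u v : G, edge u v -> f u <> f v.

Definition b_vertex f (v : G) : Prop :=
  forall j : 'I_k, j <> f v -> exists w : G, edge v w /\ f w = j.

Definition b_coloring f : Prop :=
  proper_coloring f /\
  forall i : 'I_k, exists v : G, f v = i /\ b_vertex f v.
End BColoring.

Definition b_spectrum (G : sgraph) : set nat :=
  fun k => 0 < k /\ exists f : G -> 'I_k, b_coloring f.

(* No negation and no constants: these formulas are monotone in the four
   basic ones, whose truth is relative to a pair of vertices of a product. *)
Inductive adj_formula :=
  | EqL | EqR | AdjL | AdjR
  | Conj of adj_formula & adj_formula
  | Disj of adj_formula & adj_formula.

Fixpoint adj_holds (P : adj_formula) (G H : sgraph) (a b : G * H) : bool :=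
  match P with
  | EqL => a.1 == b.1
  | EqR => a.2 == b.2
  | AdjL => edge a.1 b.1
  | AdjR => edge a.2 b.2
  | Conj P1 P2 => adj_holds P1 a b && adj_holds P2 a b
  | Disj P1 P2 => adj_holds P1 a b || adj_holds P2 a b
  end.

Record adj_product := AdjProduct {
  adj_cond : adj_formula;
  adj_cond_irr : forall (G H : sgraph) (a : G * H), ~~ adj_holds adj_cond a a
}.

Section Product.
Variables (P : adj_product) (G H : sgraph).
Definition product_rel : rel (G * H)%type := fun a b => adj_holds (adj_cond P) a b.
Lemma product_sym : symmetric product_rel.
Proof.
move=> a b; rewrite /product_rel.
elim: (adj_cond P) => [||||P1 IH1 P2 IH2|P1 IH1 P2 IH2] /=.
- by rewrite eq_sym.
- by rewrite eq_sym.
- exact: edge_sym.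
- exact: edge_sym.
- by rewrite IH1 IH2.
- by rewrite IH1 IH2.
Qed.
Lemma product_irr : irreflexive product_rel.
Proof. by move=> a; apply/negbTE/adj_cond_irr. Qed.
Definition product_graph : sgraph := SGraph product_sym product_irr.
End Product.

Notation "''K_' n" := (complete_graph n)
  (at level 8, n at level 2, format "''K_' n").
Notation "G ⊙[ P ] H" := (product_graph P G H)
  (at level 40, P at level 200, left associativity, format "G  ⊙[ P ]  H").

(* Main.v *)
Require Import Defs.
From mathcomp Require Import all_boot.
From mathcomp Require Import classical_sets.
Local Open Scope classical_set_scope.

(** Call a map [phi : X -> Y] between graphs a b-morphism when it preserves
    edges and every vertex [y] of [Y] has a preimage [x] from which every edge
    leaving [y] lifts to an edge leaving [x].  A b-coloring of [X] with [k]
    colors is exactly a b-morphism from [X] to the complete graph on [k]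
    vertices ([b_coloringP]): the distinguished preimage of a color is a
    b-vertex of its class.  B-morphisms compose ([b_morphism_comp]), so a
    b-morphism from [X] to [Y] turns b-colorings of [Y] into b-colorings of [X]
    and the b-spectrum of [Y] is contained in that of [X]
    ([b_spectrum_pullback]).

    Adjacency products are functorial for b-morphisms ([b_morphism_product]),
    because the product condition is monotone in the four basic formulas and
    these can be transported one coordinate at a time.  The inclusions of the
    theorem then follow by multiplying a b-coloring of one factor, seen as a
    b-morphism to a complete graph, by the identity of the other factor. *)

(** Lifting is asked at one preimage of each vertex, and not at all of them as
    for locally surjective homomorphisms, because a color class of a b-coloring
    may contain vertices that are not b-vertices. *)
Definition b_morphism {X Y : sgraph} (phi : X -> Y) : Prop :=
  (forall u v, edge u v -> edge (phi u) (phi v)) /\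
  forall y, exists x, phi x = y /\
    forall y', edge y y' -> exists x', edge x x' /\ phi x' = y'.

Lemma b_morphism_id (X : sgraph) : b_morphism (@id X).
Proof. by split=> // y; exists y; split=> // y' yy'; exists y'. Qed.

Lemma b_morphism_comp (X Y Z : sgraph) (phi : X -> Y) (psi : Y -> Z) :
  b_morphism phi -> b_morphism psi -> b_morphism (psi \o phi).
Proof.
move=> [phi_hom phi_lift] [psi_hom psi_lift].
split=> [u v uv|z]; first exact/psi_hom/phi_hom.
have [y [<- lift_y]] := psi_lift z; have [x [eq_y lift_x]] := phi_lift y.
exists x; split=> [|z' /lift_y [y' [/lift_x [x' [xx' eq_y']] <-]]] /=.
  by rewrite eq_y.
by exists x'; rewrite eq_y'.
Qed.

Lemma b_coloringP (X : sgraph) (k : nat) (f : X -> 'I_k) :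
  b_coloring f <-> b_morphism (f : X -> 'K_k).
Proof.
split=> [[f_proper f_b]|[f_hom f_lift]]; split.
- by move=> u v uv; apply/eqP/f_proper.
- move=> i; have [v [<- bv]] := f_b i.
  by exists v; split=> // j /eqP ij; apply: bv => ji; apply: ij.
- by move=> u v /f_hom /eqP.
- move=> i; have [v [<- lift_v]] := f_lift i.
  by exists v; split=> // j ji; apply: lift_v; apply/eqP => ij; apply: ji.
Qed.

Lemma b_spectrum_pullback (X Y : sgraph) (phi : X -> Y) :
  b_morphism phi -> b_spectrum Y `<=` b_spectrum X.
Proof.
move=> phi_b m [m_gt0 [f /b_coloringP f_b]]; split=> //.
by exists (f \o phi); apply/b_coloringP; apply: b_morphism_comp.
Qed.

(** True because the formulas have no negation.  The two pairs live in different
    products so that adjacency can be transported along a map of products, in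
    either direction. *)
Lemma adj_holds_mono (P : adj_formula) (G H G' H' : sgraph)
    (a b : G * H) (a' b' : G' * H') :
  (a.1 = b.1 -> a'.1 = b'.1) -> (a.2 = b.2 -> a'.2 = b'.2) ->
  (edge a.1 b.1 -> edge a'.1 b'.1) -> (edge a.2 b.2 -> edge a'.2 b'.2) ->
  adj_holds P a b -> adj_holds P a' b'.
Proof.
move=> eql eqr adjl adjr; elim: P => //= [||P1 IH1 P2 IH2|P1 IH1 P2 IH2].
- by move=> /eqP /eql ->.
- by move=> /eqP /eqr ->.
- by move=> /andP [/IH1 -> /IH2 ->].
- by move=> /orP [/IH1 ->|/IH2 ->]; rewrite ?orbT.
Qed.

(** In a product, the coordinates of adjacent vertices may be equal, adjacent
    or neither; hence lifting in the product needs a lift of every vertex [y'],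
    not only of the neighbors of [y].  The lift of [y] itself must be [x], and
    a vertex unrelated to [y] may be lifted arbitrarily. *)
Lemma b_morphism_lift (X Y : sgraph) (phi : X -> Y) (y : Y) :
  b_morphism phi ->
  exists x, phi x = y /\ forall y', exists x',
    [/\ phi x' = y', y = y' -> x = x' & edge y y' -> edge x x'].
Proof.
move=> [_ phi_lift]; have [x [eq_y lift_x]] := phi_lift y.
exists x; split=> // y'.
have [<-|neq_yy'] := eqVneq y y'; first by exists x; rewrite edge_irr.
have [/lift_x [x' [xx' eq_y']]|_] := boolP (edge y y').
  by exists x'; split=> // /eqP; rewrite (negPf neq_yy').
have [x' [eq_y' _]] := phi_lift y'.
by exists x'; split=> // /eqP; rewrite (negPf neq_yy').
Qed.

Lemma b_morphism_product (P : adj_product) (G G' H H' : sgraph)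
    (phi : G -> G') (psi : H -> H') :
  b_morphism phi -> b_morphism psi ->
  b_morphism ((fun a => (phi a.1, psi a.2)) : G ⊙[P] H -> G' ⊙[P] H').
Proof.
move=> phi_b psi_b; split=> [a b|[y z]].
  apply: adj_holds_mono => /= [->|->||] //; [exact: phi_b.1|exact: psi_b.1].
have [u [eq_y lift_u]] := b_morphism_lift _ _ phi y phi_b.
have [v [eq_z lift_v]] := b_morphism_lift _ _ psi z psi_b.
exists (u, v); split=> [|[y' z'] adj_yz]; first by rewrite /= eq_y eq_z.
have [u' [eq_y' eq_u adj_u]] := lift_u y'.
have [v' [eq_z' eq_v adj_v]] := lift_v z'.
exists (u', v'); split; last by rewrite /= eq_y' eq_z'.
exact: adj_holds_mono adj_yz.
Qed.

Lemma b_spectrum_productl (P : adj_product) (G H : sgraph) (k : nat) :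
  b_spectrum G k -> b_spectrum ('K_k ⊙[P] H) `<=` b_spectrum (G ⊙[P] H).
Proof.
move=> [_ [f /b_coloringP f_b]].
exact: b_spectrum_pullback (b_morphism_product P _ _ _ _ _ _ f_b
                              (b_morphism_id H)).
Qed.

Lemma b_spectrum_productr (P : adj_product) (G H : sgraph) (k : nat) :
  b_spectrum H k -> b_spectrum (G ⊙[P] 'K_k) `<=` b_spectrum (G ⊙[P] H).
Proof.
move=> [_ [f /b_coloringP f_b]].
exact: b_spectrum_pullback (b_morphism_product P _ _ _ _ _ _
                              (b_morphism_id G) f_b).
Qed.

Theorem corollary2 (P : adj_product) (G H : sgraph)
    (hG : (0 < #|G|)%N) (hH : (0 < #|H|)%N) :
  \bigcup_(k in b_spectrum G) \bigcup_(k' in b_spectrum H)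
      b_spectrum ('K_k ⊙[P] 'K_k')
    `<=` (\bigcup_(k in b_spectrum H) b_spectrum (G ⊙[P] 'K_k))
         `&` (\bigcup_(k in b_spectrum G) b_spectrum ('K_k ⊙[P] H))
  /\
  (\bigcup_(k in b_spectrum H) b_spectrum (G ⊙[P] 'K_k))
      `|` (\bigcup_(k in b_spectrum G) b_spectrum ('K_k ⊙[P] H))
    `<=` b_spectrum (G ⊙[P] H).
Proof.
split=> m.
  move=> [k Gk [k' Hk' m_in]]; split.
    by exists k' => //; apply: b_spectrum_productl Gk _ m_in.
  by exists k => //; apply: b_spectrum_productr Hk' _ m_in.
move=> [[k Hk]|[k Gk]]; first exact: b_spectrum_productr.
exact: b_spectrum_productl.
Qed.
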